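(* Let $\ell=\ell(n)$ satisfy $3\log n/2\le\ell<n/2$, and let $G=(V,E)$ be an $n$-vertex graph with minimum degree $\delta(G)\ge n/2+\ell$. Then $G$ admits a strong $d$-rigid partition for $d=2\ell/(3\log n)$.
   Context: For $A,B\subseteq V$, $G[A,B]$ is the graph on $A\cup B$ with the edges of $G$ having one endpoint in $A$ and the other in $B$. A strong $d$-rigid partition of $G$ is a partition $V=V_1\cup\dots\cup V_d$ into nonempty sets such that $G[V_i,V_j]$ is connected for all $1\le i\le j\le d$. Logarithms are natural; the paper omits floor and ceiling signs, so $d$ is understood as rounded to an integer. *)

(* Defs.v *)
From HB Require Import structures.
From mathcomp Require Import all_boot all_order all_algebra.
From mathcomp Require Import reals exp.

Set Implicit Arguments.
Unset Strict Implicit.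
Unset Printing Implicit Defensive.

Section Graph.
Variables (V : finType) (e : rel V).

Definition simple_graph : Prop := symmetric e /\ irreflexive e.

Definition degree (v : V) : nat := #|[set w | e v w]|.

(* For irreflexive [e] every degree is below [#|V|], so the default value of
   the iterated minimum matters only when [V] is empty. *)
Definition min_degree : nat := \big[minn/#|V|]_(v : V) degree v.

(* The edges of G[A, B]; its vertex set is [A :|: B].  [A] and [B] may overlap,
   and for [A = B] this is the subgraph of G induced by [A]. *)
Definition edges_between (A B : {set V}) : rel V :=
  [rel u v | e u v && ((u \in A) && (v \in B) || (u \in B) && (v \in A))].

(* Connectedness of the graph with vertex set [W] and adjacency [f], for [f]
   relating only elements of [W]. *)
Definition connected_graph (W : {set V}) (f : rel V) : Prop :=
  W != set0 /\ {in W &, forall u v, connect f u v}.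

Definition connected_between (A B : {set V}) : Prop :=
  connected_graph (A :|: B) (edges_between A B).

(* [partition] requires all parts to be nonempty.  The parts are not numbered:
   G[A, B] = G[B, A], so ranging over all pairs of parts, equal ones included,
   is ranging over the pairs i <= j. *)
Definition strong_rigid_partition (d : nat) (P : {set {set V}}) : Prop :=
  [/\ partition P [set: V], #|P| = d &
      {in P &, forall A B, connected_between A B}].

End Graph.

(* Main.v *)
(** Colour the vertices uniformly at random with d colours.  Any two vertices
    have at least 2 delta(G) - n >= 2 ell common neighbours, so a given colour
    is missing among them with probability at most
    (1 - 1/d)^(2 ell) <= exp(- 2 ell / d) <= n^(-3).  There are n^2 d < n^3
    triples of two vertices and a colour, hence in some colouring any two
    vertices have a common neighbour of every colour.  Then G[V_i, V_j] is
    connected: two vertices of V_i have a common neighbour in V_j, and u in V_i,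
    v in V_j are joined through a neighbour of u in V_j. *)

Require Import Defs.
From HB Require Import structures.
From mathcomp Require Import all_boot all_order all_algebra.
From mathcomp Require Import reals sequences exp.
From mathcomp Require Import zify ring lra.

Set Implicit Arguments.
Unset Strict Implicit.
Unset Printing Implicit Defensive.

Import Order.TTheory GRing.Theory Num.Theory.

(** The values of a colouring are independent: each vertex of [C] has [d.-1] admissible colours,
    every other vertex has [d]. *)
Lemma card_ffun_avoid (V : finType) (d : nat) (C : {set V}) (i : 'I_d) :
  #|[set f : {ffun V -> 'I_d} | [forall w in C, f w != i]]|
    = d.-1 ^ #|C| * d ^ #|~: C|.
Proof.
transitivity #|family (fun w => [pred j : 'I_d | (w \in C) ==> (j != i)])|.
  apply: eq_card => f; rewrite inE.
  by apply/'forall_implyP/familyP => /= fC w; [apply/implyP | apply/implyP]; exact: fC.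
rewrite card_family foldrE big_image /= (bigID (mem C)) /=; congr (_ * _).
  rewrite (eq_bigr (fun=> d.-1)) ?prod_nat_const // => w wC.
  rewrite -[in RHS](card_ord d) -(cardC1 i).
  by apply: eq_card => j; rewrite !inE wC.
rewrite (eq_bigr (fun=> d)) => [|w wC].
  by rewrite -(prod_nat_const (mem (~: C))); apply: eq_bigl => w; rewrite inE.
rewrite -[in RHS](card_ord d).
by apply: eq_card => j; rewrite !inE (negPf wC).
Qed.

(** The union bound over pairs of an index and a colour, as a count of colourings: probabilities
    appear multiplied by [d ^ #|V|]. *)
Lemma ex_colouring_onto (V K : finType) (d m : nat) (C : K -> {set V}) :
  0 < d -> (forall k, m <= #|C k|) -> #|K| * d * d.-1 ^ m < d ^ m ->
  exists f : {ffun V -> 'I_d}, forall k i, exists2 w, w \in C k & f w = i.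
Proof.
move=> d_gt0 leC ltKd.
pose bad (p : K * 'I_d) :=
  [set f : {ffun V -> 'I_d} | [forall w in C p.1, f w != p.2]].
(* A bad event has probability at most $(1 - 1/d)^m$, here with denominators cleared. *)
have card_bad p : #|bad p| * d ^ m <= d.-1 ^ m * d ^ #|V|.
  rewrite card_ffun_avoid -(cardsC (C p.1)) expnD -(subnK (leC p.1)) !expnD.
  have : d.-1 ^ (#|C p.1| - m) <= d ^ (#|C p.1| - m).
    by case: (_ - m) => // k; rewrite leq_exp2r // leq_pred.
  set a := _ ^ _; set b := _ ^ _; set x := _ ^ m; set y := _ ^ m; set z := _ ^ _.
  move=> le_ab; rewrite [leqLHS](_ : _ = a * (x * y * z)); last by ring.
  by rewrite [leqRHS](_ : _ = b * (x * y * z)) ?leq_mul2r ?le_ab ?orbT //; ring.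
have lt_bad : #|\bigcup_p bad p| < #|{ffun V -> 'I_d}|.
  rewrite card_ffun card_ord -(ltn_pmul2r (_ : 0 < d ^ m)) ?expn_gt0 ?d_gt0 //.
  apply: (@leq_ltn_trans (#|K| * d * d.-1 ^ m * d ^ #|V|)); last first.
    by rewrite [ltnRHS]mulnC ltn_pmul2r // expn_gt0 d_gt0.
  apply: leq_trans (leq_mul (unstable.card_big_setU _ _ _) (leqnn _)) _.
  rewrite big_distrl /= (leq_trans (leq_sum _ (fun p _ => card_bad p))) //.
  by rewrite sum_nat_const card_prod card_ord !mulnA.
have [f fP] : exists f, f \notin \bigcup_p bad p.
  apply/existsP; apply: contraLR lt_bad; rewrite negb_exists -leqNgt.
  move=> /forallP all_bad; rewrite -cardsT subset_leq_card //.
  by apply/subsetP => f _; have := all_bad f; rewrite negbK.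
exists f => k i.
have : f \notin bad (k, i) by apply: contra fP => fb; apply/bigcupP; exists (k, i).
rewrite inE negb_forall => /existsP[w]; rewrite negb_imply negbK => /andP[wC /eqP].
by exists w.
Qed.

Section Graph.
Variables (V : finType) (e : rel V).

Lemma min_degree_le v : min_degree e <= degree e v.
Proof.
rewrite /min_degree; have := mem_index_enum v.
elim: (index_enum V) => //= x r IHr; rewrite inE big_cons geq_min.
by case/predU1P => [<-|/IHr ->]; rewrite ?leqnn ?orbT.
Qed.

(** Inclusion-exclusion, the union of the two neighbourhoods having at most [#|V|] elements. *)
Lemma card_common_neighbours u v :
  (min_degree e).*2 - #|V| <= #|[set w | e u w && e v w]|.
Proof.
have -> : [set w | e u w && e v w] = [set w | e u w] :&: [set w | e v w].
  by apply/setP => w; rewrite !inE.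
rewrite cardsI -addnn leq_sub ?max_card //.
exact: leq_add (min_degree_le u) (min_degree_le v).
Qed.

Lemma edges_between_sym (A B : {set V}) :
  symmetric e -> symmetric (edges_between e A B).
Proof.
move=> e_sym u v.
by rewrite /edges_between /= e_sym orbC (andbC (v \in A)) (andbC (v \in B)).
Qed.

Lemma connected_between_common (A B : {set V}) :
  symmetric e -> A != set0 ->
  (forall u v, exists2 w, w \in A & e u w && e v w) ->
  (forall u v, exists2 w, w \in B & e u w && e v w) ->
  connected_between e A B.
Proof.
move=> e_sym A0 cA cB; split.
  by have /set0Pn[x xA] := A0; apply/set0Pn; exists x; rewrite inE xA.
pose h := edges_between e A B.
have h_sym : connect_sym h by apply/sym_connect_sym/edges_between_sym.
have conn1 x y : x \in A -> y \in B -> e x y -> connect h x y.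
  by move=> xA yB exy; apply: connect1; rewrite /h /edges_between /= exy xA yB.
have connA u v : u \in A -> v \in A -> connect h u v.
  move=> uA vA; have [w wB /andP[euw evw]] := cB u v.
  by apply: (connect_trans (conn1 _ _ uA wB euw)); rewrite h_sym conn1.
have toA u : u \in A :|: B -> exists2 x, x \in A & connect h u x.
  rewrite inE => /orP[uA|uB]; first by exists u; rewrite ?connect0.
  (* A common neighbour of [u] with itself is just a neighbour of [u]. *)
  have [w wA /andP[euw _]] := cA u u.
  by exists w => //; rewrite h_sym conn1 // e_sym.
move=> u v /toA[x xA ux] /toA[y yA vy].
apply: connect_trans ux (connect_trans (connA _ _ xA yA) _).
by rewrite h_sym.
Qed.

Lemma strong_rigid_partition_common (d : nat) (f : V -> 'I_d) :
  symmetric e -> 0 < #|V| ->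
  (forall u v i, exists2 w, f w = i & e u w && e v w) ->
  strong_rigid_partition e d [set f @^-1: [set i] | i : 'I_d].
Proof.
move=> e_sym /card_gt0P[v0 _] fP.
pose cls i := f @^-1: [set i].
have in_cls i w : (w \in cls i) = (f w == i) by rewrite !inE.
have cls_neq0 i : cls i != set0.
  by have [w fw _] := fP v0 v0 i; apply/set0Pn; exists w; rewrite in_cls fw.
(* Distinct colours give distinct classes, so that the set of classes has exactly [d] elements. *)
have cls_inj : injective cls.
  move=> i j eq_ij; have /set0Pn[w wi] := cls_neq0 i.
  have wj : w \in cls j by rewrite -eq_ij.
  by move: wi wj; rewrite !in_cls => /eqP <- /eqP.
split.
- apply/and3P; split.
  + rewrite eqEsubset subsetT; apply/subsetP => v _; apply/bigcupP.
    by exists (cls (f v)); rewrite ?imset_f // in_cls.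
  + apply/trivIsetP => _ _ /imsetP[i _ ->] /imsetP[j _ ->] neq_ij.
    rewrite -setI_eq0; apply: contraR neq_ij => /set0Pn[w].
    by rewrite inE => /andP[]; rewrite -!/(cls _) !in_cls => /eqP-> /eqP->.
  + by apply/imsetP => -[i _ /esym/eqP]; rewrite (negPf (cls_neq0 i)).
- by rewrite card_imset // card_ord.
- move=> _ _ /imsetP[i _ ->] /imsetP[j _ ->].
  apply: connected_between_common (cls_neq0 i) _ _ => // u v.
    by have [w fw euvw] := fP u v i; exists w; rewrite // in_cls fw.
  by have [w fw euvw] := fP u v j; exists w; rewrite // in_cls fw.
Qed.

End Graph.

Local Open Scope ring_scope.

(** From $\ln(1+y) \le y$ at $y = 1/x - 1$: $-\ln x \le 1/x - 1 \le -1/2$. *)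
Lemma half_le_ln (R : realType) (x : R) : 2 <= x -> 2^-1 <= ln x.
Proof.
move=> x_ge2; have x_gt0 : 0 < x by lra.
have xV : x^-1 <= 2^-1 by rewrite lef_pV2 ?posrE //; lra.
have xV_gt0 : 0 < x^-1 by rewrite invr_gt0.
have := @le_ln1Dx R (x^-1 - 1); rewrite subrKC lnV ?posrE // => lnx.
have {}lnx := lnx ltac:(lra); lra.
Qed.

(** Multiply $n^3 \le e^{m/d}$, which is the hypothesis on [m], by the [m]-th power of $d - 1 \le d
    e^{-1/d}$; the exponentials cancel. *)
Lemma expn_pred_bound (R : realType) (n d m : nat) :
  (0 < n)%N -> (0 < d)%N -> d%:R * (3 * ln n%:R) <= m%:R :> R ->
  (n ^ 3 * d.-1 ^ m <= d ^ m)%N.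
Proof.
move=> n_gt0 d_gt0 le_m.
have n0 : 0 < n%:R :> R by rewrite ltr0n.
have d0 : 0 < d%:R :> R by rewrite ltr0n.
have le_pred : d.-1%:R <= d%:R * expR (- d%:R^-1) :> R.
  rewrite -(ler_pM2l (_ : 0 < d%:R^-1)) ?invr_gt0 // mulKf ?gt_eqF //.
  apply: le_trans (expR_ge1Dx _).
  by rewrite -subn1 natrB // mulrBr mulVf ?gt_eqF // mulr1.
have le_n3 : n%:R ^+ 3 <= expR (d%:R^-1) ^+ m :> R.
  rewrite -expRM_natr mulrC -[n%:R]lnK ?posrE // -expRM_natr ler_expR.
  by rewrite ler_pdivlMr // [leLHS](_ : _ = d%:R * (3 * ln n%:R)) //; ring.
rewrite -(ler_nat R) natrM !natrX.
apply: (@le_trans _ _ (expR (d%:R^-1) ^+ m * (d%:R * expR (- d%:R^-1)) ^+ m)).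
  by apply: ler_pM; rewrite ?exprn_ge0 // lerXn2r // nnegrE ?mulr_ge0 ?expR_ge0.
by rewrite -exprMn mulrCA expRxMexpNx_1 mulr1.
Qed.

Theorem theorem1p14 (R : realType) (n : nat) (ell : R)
    (V : finType) (e : rel V) :
  3 * ln n%:R / 2 <= ell -> ell < n%:R / 2 ->
  simple_graph e -> #|V| = n ->
  n%:R / 2 + ell <= (min_degree e)%:R ->
  exists P : {set {set V}},
    strong_rigid_partition e (Num.truncn (2 * ell / (3 * ln n%:R))) P.
Proof.
move=> le_ell lt_ell [e_sym e_irr] cardV le_deg.
(* For $n = 0$ the convention $\ln 0 = 0$ gives $0 \le \ell < 0$; for $n = 1$ the only vertex has
   degree 0, below $1/2 + \ell$. *)
have n_ge2 : (1 < n)%N.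
  case: n cardV le_ell lt_ell le_deg => [|[|//]] cardV.
    by rewrite ln0 //; lra.
  rewrite ln1 => le_ell _ le_deg.
  have /card_gt0P[v _] : (0 < #|V|)%N by rewrite cardV.
  have: (min_degree e <= 0)%N.
    rewrite (leq_trans (min_degree_le e v)) // leqn0 cards_eq0.
    apply/eqP/setP => w; rewrite !inE.
    have /card_le1P/(_ v isT w) : (#|V| <= 1)%N by rewrite cardV.
    by rewrite !inE => /esym/eqP ->; exact: e_irr.
  by rewrite -(ler_nat R); lra.
have n_gt0 : (0 < n)%N by lia.
have lnn : 2^-1 <= ln n%:R :> R by apply: half_le_ln; rewrite ler_nat.
set d := Num.truncn _.
(* The lower bound on [ell] ensures that rounding down leaves at least one colour. *)
have ratio_ge1 : 1 <= 2 * ell / (3 * ln n%:R).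
  by rewrite ler_pdivlMr; lra.
have d_gt0 : (0 < d)%N by rewrite truncn_gt0.
have le_d : d%:R * (3 * ln n%:R) <= 2 * ell.
  by rewrite -ler_pdivlMr ?truncn_le; lra.
(* $3d/2 \le 3 d \ln n \le 2\ell < n$. *)
have lt_dn : (d < n)%N.
  by rewrite -(ltr_nat R); have : 0 <= d%:R :> R by []; nra.
have le_common : 2 * ell <= ((min_degree e).*2 - n)%:R.
  apply: (@le_trans _ _ ((min_degree e).*2%:R - n%:R)); first by rewrite -addnn natrD; lra.
  by rewrite lerBlDr -natrD ler_nat; lia.
pose m := ((min_degree e).*2 - n)%N.
pose C (p : V * V) := [set w | e p.1 w && e p.2 w].
have le_C p : (m <= #|C p|)%N by rewrite /m -cardV card_common_neighbours.
have lt_dm : (#|{: V * V}| * d * d.-1 ^ m < d ^ m)%N.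
  rewrite card_prod cardV.
  have le_nm := expn_pred_bound n_gt0 d_gt0 (le_trans le_d le_common).
  (* If [d = 1] this power can vanish, and then $n^2 d < n^3$ cannot be multiplied by it strictly;
     but the left side is then 0. *)
  have [-> | a_gt0] := posnP (d.-1 ^ m)%N; first by rewrite muln0 expn_gt0 d_gt0.
  apply: leq_trans le_nm; rewrite ltn_pmul2r // !expnS muln1 mulnA.
  by rewrite ltn_pmul2l // muln_gt0 n_gt0.
have [f fP] := ex_colouring_onto d_gt0 le_C lt_dm.
exists [set f @^-1: [set i] | i : 'I_d].
apply: strong_rigid_partition_common; rewrite ?cardV // => u v i.
by have [w] := fP (u, v) i; rewrite inE => euvw fw; exists w.
Qed.
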